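(* For each (small) $\varepsilon>0$ let $w^\varepsilon,z^\varepsilon:\Omega\to\mathbb{R}^d$ be smooth solutions of $$f(w^\varepsilon)_x+S(w^\varepsilon)=\varepsilon w^\varepsilon_{xx}\quad\text{and}\quad -f'(w^\varepsilon)^T z^\varepsilon_x+S'(w^\varepsilon)^T z^\varepsilon=\varepsilon z^\varepsilon_{xx}+p'(w^\varepsilon)\quad\text{on }\Omega,$$ respectively. Assume that outside a transition region $[\alpha^-,\alpha^+]$ both $z^\varepsilon_x$ and $w^\varepsilon_x$ have orders of magnitude independent of $\varepsilon$, i.e. there is a constant $C$ independent of $\varepsilon$ with $|w^\varepsilon_x(x)|\le C$ and $|z^\varepsilon_x(x)|\le C$ for all $x\in\Omega\setminus[\alpha^-,\alpha^+]$. Then $$\lim_{\varepsilon\to0^+}\Bigl([p(w^\varepsilon)]-[(z^\varepsilon)^T S(w^\varepsilon)]\Bigr)=0 .$$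
   Context: $\Omega=[0,1]$; $f,S:\mathbb{R}^d\to\mathbb{R}^d$ and $p:\mathbb{R}^d\to\mathbb{R}$ are given smooth functions; $\alpha\in(0,1)$ is a fixed point (the shock location of the limit problem). The transition region is $[\alpha^-,\alpha^+]:=[\alpha-\overline\alpha,\alpha+\overline\alpha]$, where $\overline\alpha=\overline\alpha(\varepsilon)>0$ tends to $0$ as $\varepsilon\to0^+$; inside it the gradient of $w^\varepsilon$ may be as large as order $1/\varepsilon$. For a smooth function $g$ depending on $\varepsilon$ the ''jump'' is defined as $$[g]:=\int_{\alpha^-}^{\alpha^+}\frac{d}{dx}g(x)\,dx .$$ No particular boundary conditions for $w^\varepsilon$, $z^\varepsilon$ are relevant. *)

(* Defs.v *)
From HB Require Import structures.
From mathcomp Require Import all_boot all_order all_algebra.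
From mathcomp Require Import all_classical all_reals all_analysis.

Set Implicit Arguments.
Unset Strict Implicit.
Unset Printing Implicit Defensive.

Import Order.TTheory GRing.Theory Num.Theory.
Import numFieldNormedType.Exports.

Local Open Scope classical_set_scope.
Local Open Scope ring_scope.

Section Defs.
Context {R : realType}.

(* Derivatives of a function on a subset [A] of the line only look at
   the values on [A]: at an endpoint of a closed interval they are the usual
   one-sided derivatives, at an interior point the usual derivative. *)
Definition diff_quotient (V : normedModType R) (g : R -> V) (x : R) : R -> V :=
  fun y => (y - x)^-1 *: (g y - g x).

Definition derive_on (V : normedModType R) (A : set R) (g : R -> V) : R -> V :=
  fun x => lim (diff_quotient g x @ within A x^').

(* Class C^oo on [A] (for [A] an interval): differentiability of every iterated
   derivative also makes all of them continuous on [A]. *)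
Definition smooth_on (V : normedModType R) (A : set R) (g : R -> V) : Prop :=
  forall (n : nat) (x : R), A x ->
    cvg (diff_quotient (iter n (derive_on A) g) x @ within A x^').

(* Class C^k on the whole space.  Testing the regularity of the differential
   against each fixed direction is the usual notion when [V] is
   finite-dimensional. *)
Fixpoint class_C (V W : normedModType R) (k : nat) (F : V -> W) : Prop :=
  match k with
  | 0 => continuous F
  | k'.+1 => (forall u, differentiable F u) /\
             (forall v, class_C k' (fun u => 'd F u v))
  end.

Definition smooth (V W : normedModType R) (F : V -> W) : Prop :=
  forall k, class_C k F.

(* Vectors of R^d are rows.  The library's ['J F u] has entry
   (i, j) equal to the i-th partial derivative of the j-th component of F, so
   the usual Jacobian matrix F'(u) is its transpose; hence the column F'(u)^T z
   is, written as a row, z *m F'(u). *)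
Definition jac (d : nat) (F : 'rV[R]_d -> 'rV[R]_d) (u : 'rV[R]_d) : 'M[R]_d :=
  ('J F u)^T.

Definition grad (d : nat) (q : 'rV[R]_d -> R) (u : 'rV[R]_d) : 'rV[R]_d :=
  \row_j 'd q u (delta_mx 0 j).

Definition dotp (d : nat) (u v : 'rV[R]_d) : R := (u *m v^T) 0 0.

Definition jump (a b : R) (g : R -> R) : R :=
  \int[lebesgue_measure]_(x in `[a, b]) derive1 g x.

End Defs.

(* Main.v *)
Require Import Defs.
From HB Require Import structures.
From mathcomp Require Import all_boot all_order all_algebra.
From mathcomp Require Import all_classical all_reals all_analysis.
From mathcomp Require Import lra.
Import Order.TTheory GRing.Theory Num.Theory.
Import numFieldNormedType.Exports.
Local Open Scope classical_set_scope.
Local Open Scope ring_scope.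

(* Pairing the w-equation with z_x and the z-equation with w_x, the flux terms
   cancel and the sum is the exact conservation law
     (p(w) - z . S(w) + eps z_x . w_x)_x = 0.
   Hence the difference of the two jumps is eps times the difference of
   z_x . w_x at the two ends of the transition region, where continuity from
   outside the region bounds |z_x| and |w_x| by C; it is O(eps). *)

(** * Derivatives relative to a set, at interior points *)

(** Near an interior point, membership in [A] holds automatically, so the restriction disappears,
    and the shift [y = h + x] gives the quotient that defines ['D_1]. *)
Lemma diff_quotient_near (R : realType) (V : normedModType R) (A : set R)
  (g : R -> V) (x : R) : nbhs x A ->
  diff_quotient g x @ within A x^' =
  (fun h => h^-1 *: (g (h *: 1 + x) - g x)) @ 0^'.
Proof.
move=> Ax; apply/funext => P; apply/propext; split=> quoP.
  have {}quoP : \forall y \near x,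
      y != x -> A y -> P (diff_quotient g x y) by [].
  suff : \forall h \near 0, h != 0 -> P (h^-1 *: (g (h *: 1 + x) - g x)) by [].
  have {}Ax : \forall y \near x, A y by [].
  move: Ax quoP; rewrite !(near_shift 0 x); apply: filterS2 => h /=.
  rewrite subr0 -(subr_eq0 _ x) /diff_quotient addrK [h *: 1]mulr1.
  by move=> Ahx /[swap] h0; apply.
have {}quoP : \forall h \near 0,
    h != 0 -> P (h^-1 *: (g (h *: 1 + x) - g x)) by [].
suff : \forall y \near x, y != x -> A y -> P (diff_quotient g x y) by [].
rewrite (near_shift 0 x); apply: filterS quoP => h /=.
rewrite subr0 -(subr_eq0 _ x) /diff_quotient addrK [h *: 1]mulr1.
by move=> /[swap] h0 /(_ h0).
Qed.

Lemma derive_onE (R : realType) (V : normedModType R) (A : set R) (g : R -> V)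
  (x : R) : nbhs x A -> derive_on A g x = 'D_1 g x.
Proof. by move=> Ax; rewrite /derive_on diff_quotient_near. Qed.

(** Gives access to the ordinary differential calculus: [n = 0] and [n = 1] provide the first and
    second derivatives of [w] and [z] inside the unit interval. *)
Lemma smooth_on_is_derive (R : realType) (V : normedModType R) (A : set R)
  (g : R -> V) (n : nat) (x : R) :
  smooth_on A g -> nbhs x A ->
  is_derive x 1 (iter n (derive_on A) g) (iter n.+1 (derive_on A) g x).
Proof.
move=> sg Ax; split; last by rewrite /= derive_onE.
rewrite /derivable -(diff_quotient_near _ _ _ _ _ Ax).
apply: sg; exact: nbhs_singleton Ax.
Qed.

(** * Algebra, bounds and calculus of the dot product *)

Section dot_product.
Context {R : realType} {d : nat}.
Implicit Types (u v : R -> 'rV[R]_d) (x : R).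

Lemma dotpE (a b : 'rV[R]_d) : dotp a b = \sum_j a 0 j * b 0 j.
Proof. by rewrite /dotp mxE; apply: eq_bigr => j _; rewrite mxE. Qed.

Lemma dotpC (a b : 'rV[R]_d) : dotp a b = dotp b a.
Proof. by rewrite !dotpE; apply: eq_bigr => j _; rewrite mulrC. Qed.

Lemma dotpDl (a b c : 'rV[R]_d) : dotp (a + b) c = dotp a c + dotp b c.
Proof. by rewrite /dotp mulmxDl mxE. Qed.

Lemma dotpNl (a c : 'rV[R]_d) : dotp (- a) c = - dotp a c.
Proof. by rewrite /dotp mulNmx mxE. Qed.

Lemma dotpZl (k : R) (a c : 'rV[R]_d) : dotp (k *: a) c = k * dotp a c.
Proof. by rewrite /dotp -scalemxAl mxE. Qed.

(** The transpose in [jac] moves to [b] under the pairing, and [b *m 'J F y] is the differential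
    applied to [b]. This adjunction is what lets the two flux terms cancel. *)
Lemma dotp_jac (F : 'rV[R]_d -> 'rV[R]_d) (y a b : 'rV[R]_d) :
  dotp (a *m jac F y) b = dotp a ('d F y b).
Proof. by rewrite /dotp /jac -mulmxA -trmx_mul -(mul_rV_lin1 ('d F y)). Qed.

Lemma dotp_grad (q : 'rV[R]_d -> R) (y b : 'rV[R]_d) :
  dotp (grad q y) b = 'd q y b.
Proof.
rewrite dotpE [in RHS](row_sum_delta b) linear_sum; apply: eq_bigr => j _.
by rewrite linearZ/= mxE mulrC.
Qed.

Lemma normr_coord_le (a : 'rV[R]_d) j : `|a 0 j| <= `|a|.
Proof.
rewrite [leRHS]/Num.Def.normr/= mx_normrE.
exact: (le_bigmax _ (fun ij => `|a ij.1 ij.2|) (0, j)).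
Qed.

(** The norm on rows is the largest absolute value of an entry, so each of the [d] products is at
    most [C ^+ 2]; hence the factor [d%:R]. *)
Lemma normr_dotp_le (a b : 'rV[R]_d) (C : R) :
  `|a| <= C -> `|b| <= C -> `|dotp a b| <= d%:R * C ^+ 2.
Proof.
move=> aC bC; rewrite dotpE (le_trans (ler_norm_sum _ _ _))//.
rewrite (le_trans (y := \sum_(j < d) C ^+ 2))//.
  apply: ler_sum => j _; rewrite normrM expr2 ler_pM//.
    exact: le_trans (normr_coord_le _ _) _.
  exact: le_trans (normr_coord_le _ _) _.
by rewrite sumr_const card_ord mulr_natl.
Qed.

Lemma continuous_dotp u v x : {for x, continuous u} -> {for x, continuous v} ->
  {for x, continuous (fun y => dotp (u y) (v y))}.
Proof.
move=> cu cv.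
have -> : (fun y => dotp (u y) (v y)) = (fun y => \sum_j u y 0 j * v y 0 j).
  by apply/funext => y; rewrite dotpE.
apply: cvg_big => [|j _]; first exact: add_continuous.
apply: cvgM.
  exact: (cvg_comp _ _ cu (@coord_continuous _ _ _ _ _ _)).
exact: (cvg_comp _ _ cv (@coord_continuous _ _ _ _ _ _)).
Qed.

Lemma is_derive_coord u x (du : 'rV[R]_d) j :
  is_derive x 1 u du -> is_derive x 1 (fun y => u y 0 j) (du 0 j).
Proof.
move=> [dux <-]; rewrite derive_mx// mxE; apply: derivableP.
by move/derivable_mxP : dux; exact.
Qed.

Lemma is_derive_dotp u v x (du dv : 'rV[R]_d) :
  is_derive x 1 u du -> is_derive x 1 v dv ->
  is_derive x 1 (fun y => dotp (u y) (v y)) (dotp du (v x) + dotp (u x) dv).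
Proof.
move=> udu vdv.
have -> : (fun y => dotp (u y) (v y)) =
    \sum_(j < d) ((fun y => u y 0 j) * (fun y => v y 0 j)).
  by apply/funext => y; rewrite dotpE fct_sumE.
apply: is_derive_eq.
  apply: is_derive_sum => j; apply: is_deriveM; exact: is_derive_coord.
rewrite !dotpE -big_split/=; apply: eq_bigr => j _.
by rewrite addrC; congr (_ + _); exact: mulrC.
Qed.

End dot_product.

(** * Chain rule and continuity of differentials along a curve *)

Lemma is_derive_continuous (R : realType) (V : normedModType R) (g : R -> V)
  (x : R) (dg : V) : is_derive x 1 g dg -> {for x, continuous g}.
Proof.
by move=> [dgx _]; apply/differentiable_continuous/derivable1_diffP.
Qed.

Lemma is_derive_comp_diff (R : realType) (V W : normedModType R) (F : V -> W)
  (u : R -> V) (x : R) (du : V) :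
  differentiable F (u x) -> is_derive x 1 u du ->
  is_derive x 1 (F \o u) ('d F (u x) du).
Proof.
move=> dF [/derivable1_diffP dux <-].
have dFu := differentiable_comp dux dF.
by split; [exact/derivable1_diffP|rewrite !deriveE// diff_comp].
Qed.

(** [class_C 1] controls the differential along fixed directions only, whereas the direction [v y]
    moves. Expanding it in the standard basis leaves a finite sum of coordinates of [v] times
    partial derivatives of [F] along [u]. *)
Lemma continuous_diff_app (R : realType) (W : normedModType R) (d : nat)
  (F : 'rV[R]_d -> W) (u v : R -> 'rV[R]_d) (x : R) :
  class_C 1 F -> {for x, continuous u} -> {for x, continuous v} ->
  {for x, continuous (fun y => 'd F (u y) (v y))}.
Proof.
move=> [dF cF] cu cv.
have -> : (fun y => 'd F (u y) (v y)) =
    (fun y => \sum_(j < d) v y 0 j *: 'd F (u y) (delta_mx 0 j)).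
  apply/funext => y; rewrite [in LHS](row_sum_delta (v y)) linear_sum.
  by apply: eq_bigr => j _; rewrite linearZ.
apply: cvg_big => [|j _]; first exact: add_continuous.
apply: cvgZ; first exact: (cvg_comp _ _ cv (@coord_continuous _ _ _ _ _ _)).
exact: (cvg_comp _ _ cu (cF _ _)).
Qed.

(** * Jumps, constancy and endpoint bounds on an interval *)

(** Fundamental theorem of calculus. Naming the derivative [f] explicitly lets its continuity be
    checked from a formula instead of from [derive1 F]. *)
Lemma jumpE (R : realType) (a b : R) (F f : R -> R) : a < b ->
  (forall x, a <= x <= b -> is_derive x 1 F (f x)) ->
  (forall x, a <= x <= b -> {for x, continuous f}) ->
  jump a b F = F b - F a.
Proof.
move=> ab Ff cf; rewrite /jump.
have cF x : a <= x <= b -> {for x, continuous F}.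
  by move=> /Ff; exact: is_derive_continuous.
transitivity (\int[lebesgue_measure]_(x in `[a, b]) f x).
  apply: eq_Rintegral => x; rewrite inE/= in_itv/= => xab.
  by rewrite derive1E; have [] := Ff _ xab.
rewrite /Rintegral (@continuous_FTC2 _ _ F)//.
- by apply: continuous_in_subspaceT => x; rewrite inE/= in_itv/=; exact: cf.
- split.
  + move=> x; rewrite in_itv/= => /andP[ax xb].
    by have [|//] := Ff x; rewrite !ltW.
  + by apply: cvg_at_right_filter; apply: cF; rewrite lexx ltW.
  + by apply: cvg_at_left_filter; apply: cF; rewrite lexx ltW.
- move=> x; rewrite in_itv/= => /andP[ax xb].
  by rewrite derive1E; have [|//] := Ff x; rewrite !ltW.
Qed.

Lemma is_derive0_eq (R : realType) (a b : R) (F : R -> R) : a < b ->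
  (forall x, a <= x <= b -> is_derive x 1 F 0) -> F b = F a.
Proof.
move=> ab F0; apply/eqP; rewrite -subr_eq0.
have [|| c _ ->] := @MVT R F (fun=> 0) a b ab.
- by move=> x; rewrite in_itv/= => /andP[ax xb]; apply: F0; rewrite !ltW.
- apply: continuous_in_subspaceT => x; rewrite inE/= in_itv/= => /F0.
  exact: is_derive_continuous.
- by rewrite mul0r.
Qed.

(** A bound valid strictly to the right of [b] passes to the right limit at [b]. This is needed
    because the ends of the transition region belong to the region, where no bound is assumed. *)
Lemma normr_le_right (R : realType) (V : normedModType R) (u : R -> V)
  (b c C : R) : b < c -> {for b, continuous u} ->
  (forall y, b < y < c -> `|u y| <= C) -> `|u b| <= C.
Proof.
move=> bc cu uC; have cvu : `|u y| @[y --> b^'+] --> `|u b|.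
  by apply: cvg_norm; exact: cvg_at_right_filter.
apply: (cvgr_to_le cvu).
near=> y; apply: uC; apply/andP; split; near: y.
  exact: nbhs_right_gt.
exact: nbhs_right_lt.
Unshelve. all: by end_near. Qed.

Lemma normr_le_left (R : realType) (V : normedModType R) (u : R -> V)
  (a c C : R) : c < a -> {for a, continuous u} ->
  (forall y, c < y < a -> `|u y| <= C) -> `|u a| <= C.
Proof.
move=> ca cu uC; have cvu : `|u y| @[y --> a^'-] --> `|u a|.
  by apply: cvg_norm; exact: cvg_at_left_filter.
apply: (cvgr_to_le cvu).
near=> y; apply: uC; apply/andP; split; near: y.
  exact: nbhs_left_gt.
exact: nbhs_left_lt.
Unshelve. all: by end_near. Qed.

Lemma nbhs_itvcc (R : realType) (a b x : R) :
  a < x < b -> nbhs x `[a, b]%classic.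
Proof.
move=> /andP[ax xb]; have xab : x \in `]a, b[ by rewrite in_itv/= ax.
by apply: filterS (near_in_itvoo xab) => y; apply: subset_itv_oo_cc.
Qed.

(* Pairing the first equation with [z1] and the second with [w1] makes the two
   terms in [f'] (here [fw] and [fz]) cancel.  The differentials are kept
   abstract, as unification would otherwise try to unfold them. *)
Lemma pairing_identity (R : realType) (d : nat) (e c : R)
  (w1 w2 z0 z1 z2 s fw sw fz sz g : 'rV[R]_d) :
  fw + s = e *: w2 -> - fz + sz = e *: z2 + g ->
  dotp fz w1 = dotp z1 fw -> dotp sz w1 = dotp z0 sw -> dotp g w1 = c ->
  c - (dotp z1 s + dotp z0 sw) + e * (dotp z2 w1 + dotp z1 w2) = 0.
Proof.
move=> /(congr1 (fun v => dotp v z1)) wz /(congr1 (fun v => dotp v w1)) zw.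
move=> fE sE gE; move: wz zw; rewrite !dotpDl dotpNl !dotpZl fE sE gE.
rewrite (dotpC fw) (dotpC s) (dotpC w2); lra.
Qed.

(** * The jump identity for one fixed viscosity [e] *)

Section viscous_profile.
Context {R : realType} {d : nat}.
Variables (f S : 'rV[R]_d -> 'rV[R]_d) (p : 'rV[R]_d -> R).
Hypotheses (f_smooth : smooth f) (S_smooth : smooth S) (p_smooth : smooth p).
Variables (e : R) (w z : R -> 'rV[R]_d).
Hypotheses (w_smooth : smooth_on `[0, 1] w) (z_smooth : smooth_on `[0, 1] z).
Let w' := derive_on `[0, 1] w.
Let z' := derive_on `[0, 1] z.
Hypothesis w_eq : forall x : R, 0 <= x <= 1 ->
  derive_on `[0, 1] (f \o w) x + S (w x) = e *: derive_on `[0, 1] w' x.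
Hypothesis z_eq : forall x : R, 0 <= x <= 1 ->
  - (z' x *m jac f (w x)) + z x *m jac S (w x) =
  e *: derive_on `[0, 1] z' x + grad p (w x).

(** The strict inequalities keep all of [[a, b]], ends included, inside the open unit interval,
    where [derive_on] is the two-sided derivative. *)
Lemma jump_profile (a b : R) : 0 < a -> a < b -> b < 1 ->
  jump a b (p \o w) - jump a b (fun x => dotp (z x) (S (w x))) =
  e * dotp (z' a) (w' a) - e * dotp (z' b) (w' b).
Proof.
move=> a0 ab b1.
have ab01 x : a <= x <= b -> 0 < x < 1.
  by move=> /andP[ax xb]; rewrite (lt_le_trans a0)//= (le_lt_trans xb).
have dw x : a <= x <= b -> is_derive x 1 w (w' x).
  by move=> /ab01/nbhs_itvcc;
    exact: (@smooth_on_is_derive _ _ _ w 0 x w_smooth).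
have dz x : a <= x <= b -> is_derive x 1 z (z' x).
  by move=> /ab01/nbhs_itvcc;
    exact: (@smooth_on_is_derive _ _ _ z 0 x z_smooth).
have dw' x : a <= x <= b -> is_derive x 1 w' (derive_on `[0, 1] w' x).
  by move=> /ab01/nbhs_itvcc;
    exact: (@smooth_on_is_derive _ _ _ w 1 x w_smooth).
have dz' x : a <= x <= b -> is_derive x 1 z' (derive_on `[0, 1] z' x).
  by move=> /ab01/nbhs_itvcc;
    exact: (@smooth_on_is_derive _ _ _ z 1 x z_smooth).
have dF (W : normedModType R) (F : 'rV[R]_d -> W) x : smooth F -> a <= x <= b ->
    is_derive x 1 (F \o w) ('d F (w x) (w' x)).
  by move=> sF /dw; apply: is_derive_comp_diff; have [] := sF 1%N.
have dH x : a <= x <= b -> is_derive x 1 (fun x => dotp (z x) (S (w x)))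
    (dotp (z' x) (S (w x)) + dotp (z x) ('d S (w x) (w' x))).
  move=> xab; exact: is_derive_dotp (dz _ xab) (dF _ _ _ S_smooth xab).
have cdF (W : normedModType R) (F : 'rV[R]_d -> W) x :
    smooth F -> a <= x <= b -> {for x, continuous (fun x => 'd F (w x) (w' x))}.
  move=> sF xab; apply: continuous_diff_app; first exact: (sF 1%N).
    exact: is_derive_continuous (dw _ xab).
  exact: is_derive_continuous (dw' _ xab).
(* The chain rule puts the flux of the first equation in the form that [dotp_jac] produces from the
   second. *)
have fw x : a <= x <= b -> derive_on `[0, 1] (f \o w) x = 'd f (w x) (w' x).
  move=> xab; have [_ <-] := dF _ f x f_smooth xab.
  by apply: derive_onE; apply: nbhs_itvcc; exact: ab01.
rewrite (jumpE _ _ _ _ _ ab (fun x xab => dF _ p x p_smooth xab)); last first.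
  by move=> x; exact: cdF.
rewrite (jumpE _ _ _ _ _ ab dH); last first.
  move=> x xab; apply: cvgD; apply: continuous_dotp.
  - exact: is_derive_continuous (dz' _ xab).
  - exact: is_derive_continuous (dF _ _ _ S_smooth xab).
  - exact: is_derive_continuous (dz _ xab).
  - exact: cdF.
(* [Q] is the conserved quantity: its derivative is the left-hand side of [pairing_identity], so
   equal values at [a] and [b] give the claim. *)
pose Q x := p (w x) - dotp (z x) (S (w x)) + e * dotp (z' x) (w' x).
have rearrange (p1 h1 q1 p2 h2 q2 : R) :
  p1 - h1 + q1 = p2 - h2 + q2 -> p1 - p2 - (h1 - h2) = q2 - q1 by lra.
suff : Q b = Q a by exact: rearrange.
apply: is_derive0_eq => // x xab; have x01 : 0 <= x <= 1.
  by have /andP[? ?] := ab01 _ xab; rewrite !ltW.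
have dPH := is_deriveB (dF _ p x p_smooth xab) (dH _ xab).
have dQ := is_deriveD dPH
  (is_deriveZ e (is_derive_dotp _ _ _ _ _ (dz' _ xab) (dw' _ xab))).
apply: (is_derive_eq dQ).
have wz : 'd f (w x) (w' x) + S (w x) = e *: derive_on `[0, 1] w' x.
  by rewrite -(fw _ xab); exact: w_eq.
exact: (pairing_identity _ _ _ _ _ _ _ _ _ _ _ _ _ _ _ wz (z_eq _ x01)
  (dotp_jac f _ _ _) (dotp_jac S _ _ _) (dotp_grad p _ _)).
Qed.

End viscous_profile.

(** * Passage to the vanishing viscosity limit *)

Theorem theorem2 (R : realType) (d : nat)
  (f S : 'rV[R]_d -> 'rV[R]_d) (p : 'rV[R]_d -> R)
  (f_smooth : smooth f) (S_smooth : smooth S) (p_smooth : smooth p)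
  (alpha : R) (alpha_in : 0 < alpha < 1)
  (eps0 : R) (eps0_gt0 : 0 < eps0)
  (abar : R -> R)
  (abar_gt0 : forall eps : R, 0 < eps < eps0 -> 0 < abar eps)
  (abar_cvg0 : abar eps @[eps --> 0^'+] --> (0 : R))
  (w z : R -> R -> 'rV[R]_d)
  (w_smooth : forall eps : R, 0 < eps < eps0 -> smooth_on `[0, 1] (w eps))
  (z_smooth : forall eps : R, 0 < eps < eps0 -> smooth_on `[0, 1] (z eps))
  (w_eq : forall eps x : R, 0 < eps < eps0 -> 0 <= x <= 1 ->
     derive_on `[0, 1] (f \o w eps) x + S (w eps x) =
     eps *: derive_on `[0, 1] (derive_on `[0, 1] (w eps)) x)
  (z_eq : forall eps x : R, 0 < eps < eps0 -> 0 <= x <= 1 ->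
     - (derive_on `[0, 1] (z eps) x *m jac f (w eps x))
       + z eps x *m jac S (w eps x) =
     eps *: derive_on `[0, 1] (derive_on `[0, 1] (z eps)) x
       + grad p (w eps x))
  (C : R)
  (w_bound : forall eps x : R, 0 < eps < eps0 -> 0 <= x <= 1 ->
     ~ (alpha - abar eps <= x <= alpha + abar eps) ->
     `| derive_on `[0, 1] (w eps) x | <= C)
  (z_bound : forall eps x : R, 0 < eps < eps0 -> 0 <= x <= 1 ->
     ~ (alpha - abar eps <= x <= alpha + abar eps) ->
     `| derive_on `[0, 1] (z eps) x | <= C) :
  (jump (alpha - abar eps) (alpha + abar eps) (p \o w eps)
   - jump (alpha - abar eps) (alpha + abar eps)
       (fun x => dotp (z eps x) (S (w eps x))))
    @[eps --> 0^'+] --> (0 : R).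
Proof.
have /andP[alpha0 alpha1] := alpha_in.
(* Stated for a generic family [g] to serve both [w] and [z]. The left end is approached from []0,
   alpha - abar eps[] and the right end from []alpha + abar eps, 1[]. *)
have bound (g : R -> R -> 'rV[R]_d) (eps : R) : 0 < eps < eps0 ->
    (forall eps, 0 < eps < eps0 -> smooth_on `[0, 1] (g eps)) ->
    (forall eps x : R, 0 < eps < eps0 -> 0 <= x <= 1 ->
      ~ (alpha - abar eps <= x <= alpha + abar eps) ->
      `| derive_on `[0, 1] (g eps) x | <= C) ->
    0 < alpha - abar eps -> alpha + abar eps < 1 ->
    `| derive_on `[0, 1] (g eps) (alpha - abar eps) | <= C /\
    `| derive_on `[0, 1] (g eps) (alpha + abar eps) | <= C.
  move=> eps_in g_smooth g_bound a0 b1.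
  have abar0 := abar_gt0 _ eps_in.
  have cg' x : 0 < x < 1 -> {for x, continuous (derive_on `[0, 1] (g eps))}.
    move=> /nbhs_itvcc/(smooth_on_is_derive _ _ _ _ 1 _ (g_smooth _ eps_in)).
    exact: is_derive_continuous.
  split.
    apply: (@normr_le_left _ _ _ _ 0) => //.
      by apply: cg'; rewrite a0/=; lra.
    by move=> y /andP[y0 ya]; apply: g_bound => // [|/andP[? ?]]; lra.
  apply: (@normr_le_right _ _ _ _ 1) => //.
    by apply: cg'; rewrite b1 andbT; lra.
  by move=> y /andP[y0 ya]; apply: g_bound => // [|/andP[? ?]]; lra.
apply: norm_cvg0.
(* The majorant for the squeeze: [normr_dotp_le] contributes [d%:R * C ^+ 2] at each of the two
   ends. *)
have cvgC : (fun eps : R => eps * (2 * (d%:R * C ^+ 2))) @ 0^'+ --> (0 : R).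
  rewrite -[X in _ --> X](mul0r (2 * (d%:R * C ^+ 2))).
  apply: cvgM; last exact: cvg_cst.
  by apply: cvg_at_right_filter; exact: cvg_id.
apply: (squeeze_cvgr _ (cvg_cst 0) cvgC).
near=> eps.
have eps_gt0 : 0 < eps by near: eps; exact: nbhs_right_gt.
have eps_in : 0 < eps < eps0.
  by rewrite eps_gt0/=; near: eps; exact: nbhs_right_lt.
have abar0 := abar_gt0 _ eps_in.
(* Below this threshold, the distance from [alpha] to the boundary, the transition region lies
   strictly inside the unit interval, as [jump_profile] requires. *)
have abar_lt : `|abar eps| < Num.min alpha (1 - alpha).
  near: eps; apply: cvgr0_norm_lt => //.
  by rewrite lt_min alpha0 subr_gt0.
move: abar_lt; rewrite gtr0_norm// lt_min => /andP[abar_lt0 abar_lt1].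
have a0 : 0 < alpha - abar eps by lra.
have b1 : alpha + abar eps < 1 by lra.
have jumpsE := jump_profile f S p f_smooth S_smooth p_smooth eps (w eps) (z eps)
  (w_smooth _ eps_in) (z_smooth _ eps_in) (fun x => w_eq _ x eps_in)
  (fun x => z_eq _ x eps_in).
rewrite normr_ge0/= jumpsE//; last by lra.
have [wa wb] := bound w eps eps_in w_smooth w_bound a0 b1.
have [za zb] := bound z eps eps_in z_smooth z_bound a0 b1.
rewrite -mulrBr normrM gtr0_norm//; apply: ler_wpM2l; first exact: ltW.
apply: (le_trans (ler_normB _ _)); rewrite mulr2n mulrDl mul1r.
by apply: lerD; [exact: normr_dotp_le za wa|exact: normr_dotp_le zb wb].
Unshelve. all: by end_near. Qed.
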